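(* Let $(M,F)$ be a $C^0$-Berwald Finsler manifold. If $\nabla$ is an associated connection, then the parallel transport associated to $\nabla$ preserves the Binet-Legendre metric $g_F$; that is, for every smooth path $\gamma:[0,1]\to M$ from $x$ to $y$ with $\nabla$-parallel transport $P_\gamma:T_xM\to T_yM$, one has $g_F(P_\gamma\xi,P_\gamma\eta)=g_F(\xi,\eta)$ for all $\xi,\eta\in T_xM$.
   Context: A Finsler metric on a smooth $n$-dimensional manifold $M$ is a continuous function $F:TM\to[0,\infty)$ such that for every $x$ the restriction $F_x=F|_{T_xM}$ satisfies $F_x(\lambda\xi)=\lambda F_x(\xi)$ for $\lambda\ge0$, $F_x(\xi+\eta)\le F_x(\xi)+F_x(\eta)$, and $F_x(\xi)=0\Rightarrow\xi=0$. A linear connection is of class $C^k$ if its Christoffel symbols in any coordinate system are of class $C^k$. The parallel transport along $\gamma:[0,1]\to M$ from $x=\gamma(0)$ to $y=\gamma(1)$ is the linear map $P_\gamma:T_xM\to T_yM$, $P_\gamma(\xi)=\xi_1$, where $t\mapsto\xi_t$ is the solution of $\nabla_{\dot\gamma(t)}\xi_t=0$ with $\xi_0=\xi$. $F$ is a $C^k$-Berwald metric if there exists a $C^k$ torsion-free linear connection $\nabla$ on $M$ (called an associated connection) such that $F(y,P_\gamma(\xi))=F(x,\xi)$ for every smooth path $\gamma$ from $x$ to $y$ and every $\xi\in T_xM$. Binet-Legendre metric: let $\Omega_x=\{\xi\in T_xM: F(x,\xi)\le1\}$ and let $\lambda$ be any Lebesgue measure on $T_xM$. Set $g_F^*(\theta,\varphi)=\frac{n+2}{\lambda(\Omega_x)}\int_{\Omega_x}\theta(\eta)\varphi(\eta)\,d\lambda(\eta)$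 for $\theta,\varphi\in T_x^*M$; $g_F$ is the scalar product on $T_xM$ dual to $g_F^*$. *)

(* Defs.v *)
From HB Require Import structures.
From mathcomp Require Import all_boot all_order all_algebra.
From mathcomp Require Import all_classical all_reals all_analysis.

Set Implicit Arguments.
Unset Strict Implicit.
Unset Printing Implicit Defensive.

Import Order.TTheory GRing.Theory Num.Theory numFieldNormedType.Exports.
Local Open Scope classical_set_scope.
Local Open Scope ring_scope.

(* [f] is of class C^k on the open set [U].  The spaces are finite dimensional
   in all uses below, where existence and continuity of all iterated
   directional derivatives of order <= k is the usual C^k. *)
Fixpoint Ck (R : realType) (V W : normedModType R) (k : nat)
    (U : set V) (f : V -> W) : Prop :=
  match k with
  | 0 => {in U, continuous f}
  | k'.+1 => {in U, continuous f} /\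
      forall v : V, (forall x, U x -> derivable f x v) /\ Ck k' U ('D_v f)
  end.

Definition Cinfty (R : realType) (V W : normedModType R)
    (U : set V) (f : V -> W) : Prop := forall k, Ck k U f.

Section Charts.
Variables (R : realType) (n : nat) (M : topologicalType).

(* The values of [chart_map] off [chart_dom] and of [chart_inv] off [chart_cod]
   are irrelevant. *)
Record chart := Chart {
  chart_dom : set M;
  chart_cod : set 'rV[R]_n;
  chart_map :> M -> 'rV[R]_n;
  chart_inv : 'rV[R]_n -> M;
  chart_dom_open : open chart_dom;
  chart_cod_open : open chart_cod;
  chart_map_cod : forall p, chart_dom p -> chart_cod (chart_map p);
  chart_inv_dom : forall u, chart_cod u -> chart_dom (chart_inv u);
  chart_mapK : forall p, chart_dom p -> chart_inv (chart_map p) = p;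
  chart_invK : forall u, chart_cod u -> chart_map (chart_inv u) = u;
  chart_map_continuous : {in chart_dom, continuous chart_map};
  chart_inv_continuous : {in chart_cod, continuous chart_inv} }.

Definition transition (c c' : chart) : 'rV[R]_n -> 'rV[R]_n :=
  c' \o chart_inv c.

Definition transition_dom (c c' : chart) : set 'rV[R]_n :=
  [set u | chart_cod c u /\ chart_dom c' (chart_inv c u)].

Definition compatible (c c' : chart) : Prop :=
  Cinfty (transition_dom c c') (transition c c') /\
  Cinfty (transition_dom c' c) (transition c' c).

End Charts.

(* Since the atlas is maximal, its charts are all the coordinate systems. *)
Record smoothManifold (R : realType) (n : nat) := SmoothManifold {
  carrier :> topologicalType;
  manifold_hausdorff : hausdorff_space carrier;
  manifold_second_countable : @second_countable carrier;
  atlas : set (chart R n carrier);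
  atlas_cover : forall p, exists c, atlas c /\ chart_dom c p;
  atlas_compatible : forall c c', atlas c -> atlas c' -> compatible c c';
  atlas_maximal : forall c,
    (forall c', atlas c' -> compatible c c') -> atlas c }.

Arguments atlas {R n} _.

Section Geometry.
Variables (R : realType) (n : nat) (M : smoothManifold R n).

Definition chart_at (p : M) : chart R n M := sval (cid (atlas_cover p)).

(* A tangent vector at [p] is represented by its components in the chart
   [chart_at p]; [coord c p] gives its components in the chart [c]. *)
Definition tangent (p : M) : Type := 'rV[R]_n.
HB.instance Definition _ p := NormedModule.copy (tangent p) 'rV[R]_n.
HB.instance Definition _ p := Vector.copy (tangent p) 'rV[R]_n.

Definition coord (c : chart R n M) (p : M) (v : tangent p) : 'rV[R]_n :=
  'd (transition (chart_at p) c) (chart_at p p) v.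

Definition of_coord (c : chart R n M) (p : M) (v : 'rV[R]_n) : tangent p :=
  'd (transition c (chart_at p)) (c p) v.

(* The map (u, v) |-> of_coord c (chart_inv c u) v is the parametrization of
   the tangent bundle over [chart_dom c] by [chart_cod c] x R^n, so the first
   clause says that [F] is continuous on TM. *)
Definition finsler_metric (F : forall p : M, tangent p -> R) : Prop :=
  (forall c, atlas M c ->
    forall z : 'rV[R]_n * 'rV[R]_n, chart_cod c z.1 ->
      {for z, continuous (fun z : 'rV[R]_n * 'rV[R]_n =>
        F (chart_inv c z.1) (of_coord c (chart_inv c z.1) z.2))}) /\
  forall p : M,
    [/\ forall xi : tangent p, 0 <= F p xi,
        forall (a : R) (xi : tangent p), 0 <= a -> F p (a *: xi) = a * F p xi,
        forall xi eta : tangent p, F p (xi + eta) <= F p xi + F p eta &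
        forall xi : tangent p, F p xi = 0 -> xi = 0].

Definition basis_vector (i : 'I_n) : 'rV[R]_n := delta_mx 0 i.

(* [christoffel c u k i j] is Gamma^k_ij in the chart [c] at the point with
   coordinates [u], where nabla_(d_i) d_j = \sum_k Gamma^k_ij d_k. The field
   [christoffel_law] is the change of coordinates rule
     \sum_k Gamma^k_ij dT^l/du^k
       = d^2 T^l/du^i du^j + \sum_(a, b) Gamma'^l_ab dT^a/du^i dT^b/du^j
   for T the transition map from [c] to [c']. *)
Record connection := Connection {
  christoffel : chart R n M -> 'rV[R]_n -> 'I_n -> 'I_n -> 'I_n -> R;
  christoffel_law : forall (c c' : chart R n M) (p : M),
    atlas M c -> atlas M c' -> chart_dom c p -> chart_dom c' p ->
    forall l i j : 'I_n,
      let T := transition c c' in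
      let dT := fun i : 'I_n => 'D_(basis_vector i) T in
      \sum_k christoffel c (c p) k i j * dT k (c p) 0 l =
      ('D_(basis_vector i) (dT j)) (c p) 0 l +
      \sum_a \sum_b christoffel c' (c' p) l a b *
        dT i (c p) 0 a * dT j (c p) 0 b }.

Definition connection_Ck (r : nat) (nabla : connection) : Prop :=
  forall c, atlas M c -> forall k i j : 'I_n,
    Ck r (chart_cod c) (fun u => christoffel nabla c u k i j : R).

Definition torsion_free (nabla : connection) : Prop :=
  forall c, atlas M c -> forall u, chart_cod c u -> forall k i j : 'I_n,
    christoffel nabla c u k i j = christoffel nabla c u k j i.

(* A smooth path [0, 1] -> M is given by a map smooth on a neighbourhood of
   [0, 1]; its values away from [0, 1] are irrelevant. *)
Definition smooth_path (gamma : R -> M) : Prop :=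
  exists U : set R, [/\ open U, `[0, 1] `<=` U, {in U, continuous gamma} &
    forall c, atlas M c ->
      Cinfty (U `&` gamma @^-1` chart_dom c) (c \o gamma)].

(* nabla_(gamma'(t)) X_t = 0 for t in [0, 1], in every coordinate system.
   Two-sided derivatives at t = 0, 1 are harmless: [X] is arbitrary away from
   [0, 1], so a one-sided solution on [0, 1] can be continued. *)
Definition parallel_along (nabla : connection) (gamma : R -> M)
    (X : forall t : R, tangent (gamma t)) : Prop :=
  forall c, atlas M c -> forall t : R, 0 <= t <= 1 -> chart_dom c (gamma t) ->
    forall k : 'I_n,
      is_derive t 1 (fun s : R => coord c (X s) 0 k : R)
        (- \sum_i \sum_j christoffel nabla c (c (gamma t)) k i j *
             ('D_1 (c \o gamma) t) 0 i * coord c (X t) 0 j).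

(* The linear equation for parallel fields has exactly one solution with a given
   initial value, so that this characterizes the map [P]; linearity of [P] is
   a consequence. *)
Definition is_parallel_transport (nabla : connection) (gamma : R -> M)
    (P : tangent (gamma 0) -> tangent (gamma 1)) : Prop :=
  forall xi : tangent (gamma 0),
    exists X : forall t : R, tangent (gamma t),
      [/\ parallel_along nabla X, X 0 = xi & X 1 = P xi].

Definition associated_connection (r : nat) (F : forall p : M, tangent p -> R)
    (nabla : connection) : Prop :=
  [/\ connection_Ck r nabla, torsion_free nabla &
    forall (gamma : R -> M) (P : tangent (gamma 0) -> tangent (gamma 1)),
      smooth_path gamma -> is_parallel_transport nabla P ->
      forall xi : tangent (gamma 0), F (gamma 1) (P xi) = F (gamma 0) xi].

Definition berwald (r : nat) (F : forall p : M, tangent p -> R) : Prop :=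
  exists nabla : connection, associated_connection r F nabla.

End Geometry.

Definition borel (R : realType) (V : normedModType R) :=
  g_sigma_algebraType (@open V).

(* Lebesgue measures on a finite dimensional space: the nonzero translation
   invariant Borel measures that are finite on compact sets. *)
Definition is_lebesgue (R : realType) (V : normedModType R)
    (mu : {measure set (borel V) -> \bar R}) : Prop :=
  [/\ forall (v : V) (A : set (borel V)), measurable A ->
        mu [set v + (x : V) | x in (A : set V)] = mu A,
      forall K : set V, compact K -> (mu K < +oo)%E &
      mu setT <> 0%E].

Definition dual (R : realType) (V : vectType R) := 'Hom(V, R^o).

(* The scalar product on [V] dual to a scalar product [gs] on the dual of [V]:
   [gs] identifies [xi] with the form [flat gs xi] such that
   gs (flat gs xi) phi = phi xi for all phi. *)
Definition flat (R : realType) (V : vectType R) (gs : dual V -> dual V -> R)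
    (xi : V) : dual V :=
  xget 0 [set theta : dual V | forall phi : dual V, gs theta phi = phi xi].

Definition dual_product (R : realType) (V : vectType R)
    (gs : dual V -> dual V -> R) (xi eta : V) : R :=
  gs (flat gs xi) (flat gs eta).

Section BinetLegendre.
Variables (R : realType) (n : nat) (M : smoothManifold R n).

Definition unit_ball (F : forall p : M, tangent p -> R) (p : M) :
  set (tangent p) := [set xi | F p xi <= 1].
Arguments unit_ball F p : clear implicits.

Definition binet_legendre_dual (F : forall p : M, tangent p -> R) (p : M)
    (mu : {measure set (borel (tangent p)) -> \bar R})
    (theta phi : dual (tangent p)) : R :=
  n.+2%:R / fine (mu (unit_ball F p)) *
  Rintegral mu (unit_ball F p) (fun eta => theta eta * phi eta).

(* [lambda p] is the Lebesgue measure used on the tangent space at [p]. *)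
Definition binet_legendre (F : forall p : M, tangent p -> R)
    (lambda : forall p : M, {measure set (borel (tangent p)) -> \bar R})
    (p : M) (xi eta : tangent p) : R :=
  dual_product (binet_legendre_dual F (lambda p)) xi eta.

End BinetLegendre.

Arguments parallel_along {R n M} nabla gamma X.
Arguments is_parallel_transport {R n M} nabla gamma P.
Arguments binet_legendre {R n M} F lambda p xi eta.

(* Main.v *)
From HB Require Import structures.
Require Import Defs.
From mathcomp Require Import all_boot all_order all_algebra.
From mathcomp Require Import all_classical all_reals all_analysis.
From mathcomp Require Import measurable_realfun.
From mathcomp Require Import ring lra.

Import Order.TTheory GRing.Theory Num.Theory numFieldNormedType.Exports.
Local Open Scope classical_set_scope.
Local Open Scope ring_scope.

(** Parallel transport carries the unit ball of [F] at one end of the path onto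
the unit ball at the other end, and the Binet-Legendre metric is built from the
unit ball by linear algebra alone. Its only other ingredient, the Lebesgue
measure, is determined up to a factor, and that factor cancels in the average
over the ball.

Linearity and injectivity of the transport [P] come from the invariance of [F],
which plays the role of the uniqueness theorem for differential equations. If
[Z] is parallel with [Z 0 = 0], then redefining [P 0] as [Z 1] gives another
parallel transport; it preserves [F], hence [F (Z 1) = F 0 = 0] and [Z 1 = 0].
Applied to [Z - (a *: X + Y)] this gives linearity
([parallel_transport_linear]), and [P xi = 0] forces [F xi = 0].

For the measures, a translation invariant measure gives the same mass to all
dyadic cubes of a given generation, and this mass is a fixed fraction of the mass
of the unit cube. The cubes form a pi-system generating the Borel sets, so two
Lebesgue measures are proportional ([lebesgue_unique]). The image of a Lebesgue
measure under a linear automorphism is again one; therefore averages over a Borel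
set are natural under linear automorphisms ([lebesgue_mean_linear]), and so is
the dual Binet-Legendre product ([binet_legendre_dual_natural]).

Passing to the dual product is natural as well ([dual_product_natural]). *)

(** * Linearity of parallel transport *)

Section ParallelTransport.
Context {R : realType} {n : nat} {M : smoothManifold R n}.
Implicit Types (nabla : connection M) (gamma : R -> M).

(** The equation of parallel fields is linear because [coord c] is a differential,
and differentials are linear. *)
Lemma parallel_along_linear nabla gamma (a : R)
    (X Y : forall t, tangent (gamma t)) :
  parallel_along nabla gamma X -> parallel_along nabla gamma Y ->
  parallel_along nabla gamma (fun t => a *: X t + Y t).
Proof.
move=> parX parY c ac t t01 ct k.
have coordE s :
    Defs.coord c (a *: X s + Y s) = a *: Defs.coord c (X s) + Defs.coord c (Y s).
  by rewrite /Defs.coord linearP.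
have -> : (fun s => Defs.coord c (a *: X s + Y s) 0 k) =
    (a \*: (fun s => Defs.coord c (X s) 0 k : R)) +
    (fun s => Defs.coord c (Y s) 0 k).
  by apply/funext => s; rewrite coordE !mxE.
have := is_deriveD (is_deriveZ a (parX c ac t t01 ct k)) (parY c ac t t01 ct k).
move=> D; apply: (is_derive_eq D).
rewrite scalerN -opprD scaler_sumr -big_split/=; congr (- _).
apply: eq_bigr => i _; rewrite scaler_sumr -big_split/=.
apply: eq_bigr => j _; rewrite coordE !mxE -[_ *: _]/(a * _); ring.
Qed.

(** The last hypothesis allows any map [P] whose values are reached by parallel
fields, so [P] may be changed at one vector as long as a parallel field realizes
the new value; preservation of [F] then excludes any change at [0]. *)
Lemma parallel_transport_linear {nabla gamma}
    {F : forall p : M, tangent p -> R} {r}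
    {P : tangent (gamma 0) -> tangent (gamma 1)} :
  finsler_metric F -> associated_connection r F nabla -> smooth_path gamma ->
  is_parallel_transport nabla gamma P -> linear P.
Proof.
move=> [_ normF] [_ _ presF] gsmooth Ptr.
have F0 p : F p 0 = 0.
  by have [_ homF _ _] := normF p; rewrite -(scale0r (0 : tangent p)) homF ?mul0r.
have unique0 (Z : forall t, tangent (gamma t)) :
    parallel_along nabla gamma Z -> Z 0 = 0 -> Z 1 = 0.
  move=> parZ Z0.
  have P'tr : is_parallel_transport nabla gamma
      (fun xi => if xi == 0 then Z 1 else P xi).
    by move=> xi; case: eqVneq => [->|_]; [exists Z | exact: Ptr].
  have [_ _ _ defF] := normF (gamma 1); apply: defF.
  by have := presF _ _ gsmooth P'tr 0; rewrite eqxx F0.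
move=> a xi eta.
have [X [parX X0 X1]] := Ptr xi; have [Y [parY Y0 Y1]] := Ptr eta.
have [Z [parZ Z0 Z1]] := Ptr (a *: xi + eta).
(* Z - (a *: X + Y) is parallel and vanishes at 0. *)
have parXY := parallel_along_linear _ _ a _ _ parX parY.
have := unique0 _ (parallel_along_linear _ _ (-1) _ _ parXY parZ).
rewrite X0 Y0 Z0 X1 Y1 Z1 !scaleN1r addNr => /(_ erefl) /eqP.
by rewrite addr_eq0 eqr_opp => /eqP ->.
Qed.

End ParallelTransport.

(** * Continuity and Borel measurability on coordinate space *)

Section Continuity.
Context {R : realType}.

Lemma lipschitz_continuous {V W : normedModType R} (f : V -> W) (C : R) :
  (forall x y, `|f x - f y| <= C * `|x - y|) -> continuous f.
Proof.
move=> lipf x; apply/cvgrPdist_lt => e e0.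
have C0 : 0 < `|C| + 1 by rewrite ltr_wpDl.
near=> y; apply: le_lt_trans (lipf x y) _.
apply: (@le_lt_trans _ _ ((`|C| + 1) * `|x - y|)).
  by rewrite ler_wpM2r // (le_trans (ler_norm _)) // lerDl.
rewrite -ltr_pdivlMl //; near: y.
by apply: cvgr_dist_lt; rewrite // mulr_gt0 // invr_gt0.
Unshelve. all: by end_near. Qed.

Lemma entry_le_norm n (x : 'rV[R]_n) i : `|x 0 i| <= `|x|.
Proof.
have := mx_normrE x; rewrite -[mx_norm x]/(`|x|) => ->.
exact: (le_bigmax_cond _ (fun ij : 'I_1 * 'I_n => `|x ij.1 ij.2|) (j := (0, i))).
Qed.

(** Expand [x] on the standard basis; as [F] need not be even, both [e i] and
[- e i] enter the constant. *)
Lemma sublinear_le_norm n (F : 'rV[R]_n -> R) :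
  (forall x, 0 <= F x) -> (forall a x, 0 <= a -> F (a *: x) = a * F x) ->
  (forall x y, F (x + y) <= F x + F y) ->
  exists C, forall x, F x <= C * `|x|.
Proof.
move=> F_ge0 homF subF.
have F0 : F 0 = 0 by rewrite -(scale0r (0 : 'rV_n)) homF ?mul0r.
pose e i : 'rV[R]_n := delta_mx 0 i.
exists (\sum_i (F (e i) + F (- e i))) => x.
rewrite {1}(row_sum_delta x) mulr_suml.
apply: (@le_trans _ _ (\sum_i F (x 0 i *: e i))).
  elim/big_rec2: _ => [|i b y _ le_y]; first by rewrite F0.
  by apply: le_trans (subF _ _) _; rewrite lerD2l.
apply: ler_sum => i _; rewrite mulrC.
have [xi0|xi0] := leP 0 (x 0 i).
  rewrite homF // ler_pM // ?lerDl //.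
  by rewrite (le_trans (ler_norm _)) // entry_le_norm.
rewrite -[x 0 i *: _]opprK -scaleNr -scalerN homF ?oppr_ge0 ?(ltW xi0) //.
rewrite ler_pM ?oppr_ge0 ?(ltW xi0) ?lerDr //.
by rewrite -ltr0_norm // entry_le_norm.
Qed.

Lemma sublinear_continuous n (F : 'rV[R]_n -> R) :
  (forall x, 0 <= F x) -> (forall a x, 0 <= a -> F (a *: x) = a * F x) ->
  (forall x y, F (x + y) <= F x + F y) -> continuous F.
Proof.
move=> F_ge0 homF subF; have [C FC] := sublinear_le_norm n F F_ge0 homF subF.
have diff x y : F x - F y <= C * `|x - y|.
  rewrite lerBlDr; apply: le_trans (_ : F (x - y) + F y <= _).
    by rewrite -{1}(subrK y x).
  by rewrite lerD2r.
apply: (@lipschitz_continuous _ _ _ C) => x y.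
by rewrite ler_norml diff andbT lerNl opprB distrC diff.
Qed.

(** The norm of a linear map is a sublinear function, hence bounded by a multiple
of the norm. *)
Lemma linear_rV_continuous n (V : normedModType R) (f : {linear 'rV[R]_n -> V}) :
  continuous f.
Proof.
have [] := @sublinear_le_norm n (fun x => `|f x|).
- by [].
- by move=> a x a0; rewrite linearZ normrZ ger0_norm.
- by move=> x y; rewrite linearD ler_normD.
by move=> C fC; apply: (@lipschitz_continuous _ _ _ C) => x y; rewrite -linearB.
Qed.

End Continuity.

Section Borel.
Context {R : realType}.

Lemma open_borel {V : normedModType R} (U : set V) :
  open U -> measurable (U : set (borel V)).
Proof. exact: sub_sigma_algebra. Qed.

Lemma closed_borel {V : normedModType R} (C : set V) :
  closed C -> measurable (C : set (borel V)).
Proof.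
move=> clC; rewrite -[C]setCK; apply: (@measurableC _ (borel V)).
by apply: open_borel; rewrite openC.
Qed.

Lemma continuous_borel {V W : normedModType R} (f : V -> W) :
  continuous f -> measurable_fun setT (f : borel V -> borel W).
Proof.
move=> /continuousP cf.
apply: (@measurability _ _ (borel V) (borel W) setT f (@open W)) => //.
by move=> _ [U oU <-]; rewrite setTI; apply: open_borel; exact: cf.
Qed.

Lemma continuous_borel_real {V : normedModType R} (f : V -> R) :
  continuous f -> measurable_fun setT (f : borel V -> R).
Proof.
move=> /continuousP cf; apply: (measurability _ (RGenOpens.measurableE R)).
move=> _ [_ [a [b ->] <-]]; rewrite setTI.
by apply: open_borel; apply: cf; exact: interval_open.
Qed.

End Borel.

(** * Dyadic cubes and uniqueness of Lebesgue measure *)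

Section DyadicCubes.
Context {R : realType} {n : nat}.
Implicit Types (k : nat) (m : 'rV[int]_n).
Implicit Types (mu nu : {measure set (borel 'rV[R]_n) -> \bar R}).

(** The label of the dyadic cube of side [2 ^- k] that contains [x]. Cubes are fibers
of this map, so that those of one generation are disjoint and cover the space by
construction. *)
Definition cell k (x : 'rV[R]_n) : 'rV[int]_n :=
  map_mx (fun t => Num.floor (2 ^+ k * t)) x.

Definition cube k m : set (borel 'rV[R]_n) := [set x | cell k x = m].

Lemma cellE k x i : cell k x 0 i = Num.floor (2 ^+ k * x 0 i).
Proof. by rewrite mxE. Qed.

(** The label in generation [k.+1] determines the label in generation [k]: this is
why dyadic cubes are nested or disjoint. *)
Lemma cell_half k x : cell k x = map_mx (fun z => (z %/ 2)%Z) (cell k.+1 x).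
Proof.
apply/rowP => i; rewrite !mxE exprS -mulrA; set y := 2 ^+ k * _.
have := divz_eq (Num.floor (2 * y)) 2.
have := ltz_pmod (Num.floor (2 * y)) (isT : 0 < 2 :> int).
have := modz_ge0 (Num.floor (2 * y)) (isT : 2 != 0 :> int).
move: (_ %% 2)%Z (_ %/ 2)%Z => r q r0 r2 zE.
have := floor_itv (2 * y); rewrite zE => /andP[lo hi].
apply: floor_def; rewrite !intrD !intrM in lo hi *.
have r0' : 0 <= r%:~R :> R by rewrite ler0z.
have r1' : r%:~R <= 1 :> R by rewrite lerz1 -ltzD1.
lra.
Qed.

Lemma cellD k x m : cell k (x + (2 ^- k) *: map_mx intr m) = cell k x + m.
Proof.
apply/rowP => i; rewrite !mxE mulrDr mulrA divff ?expf_neq0 // mul1r.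
by rewrite floorDrz ?intr_int // intrKfloor.
Qed.

Lemma cube_translate k m :
  cube k m = [set (2 ^- k) *: map_mx intr m + x | x in cube k 0].
Proof.
apply/seteqP; split => [x /= cx|_ [x /= cx <-]]; rewrite /cube /=.
  exists (x - 2 ^- k *: map_mx intr m); last by rewrite addrC subrK.
  by rewrite /= -scalerN -map_mxN cellD cx subrr.
by rewrite addrC cellD cx add0r.
Qed.

Lemma cube_split k : cube k 0 =
  \bigcup_(e : {ffun 'I_n -> bool}) cube k.+1 (\row_i (e i)%:Z).
Proof.
apply/seteqP; split => [x cx|x [e _ cx]].
  have z2 i : (cell k.+1 x ord0 i %/ 2)%Z = 0.
    by have /rowP /(_ i) := cx; rewrite cell_half !mxE.
  exists [ffun i => cell k.+1 x 0 i == 1] => //.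
  apply/rowP => i; rewrite !mxE ffunE.
  have := ltz_pmod (cell k.+1 x 0 i) (isT : 0 < 2 :> int).
  have := modz_ge0 (cell k.+1 x 0 i) (isT : 2 != 0 :> int).
  rewrite [modz _ _]/modz z2 mul0r subr0 !cellE.
  by case: Num.floor => [[|[|]]|].
by rewrite /cube /= cell_half cx; apply/rowP => i; rewrite !mxE; case: (e i).
Qed.

Lemma measurable_cube k m : measurable (cube k m).
Proof.
have -> : cube k m = \bigcap_(i : 'I_n)
    [set x : 'rV[R]_n | Num.floor (2 ^+ k * x 0 i) = m 0 i].
  apply/seteqP; split => [x cx i _|x cx] /=.
    by rewrite -cellE cx.
  by apply/rowP => i; rewrite cellE; exact: cx.
apply: fin_bigcap_measurable => // i _.
have cont : continuous (fun x : 'rV[R]_n => 2 ^+ k * x 0 i).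
  move=> x.
  by apply: (@continuousM _ _ (fun=> 2 ^+ k) (fun y : 'rV[R]_n => y 0 i));
    [exact: cst_continuous | exact: coord_continuous].
have := continuous_borel_real _ cont measurableT.
move=> /(_ `[(m 0 i)%:~R, (m 0 i + 1)%:~R[%classic (measurable_itv _)).
rewrite setTI; congr measurable; apply/seteqP; split => x /=; rewrite in_itv/=.
  by move=> /floor_def.
by move=> <-; exact: floor_itv.
Qed.

Lemma trivIset_cube k (I : Type) (D : set I) (f : I -> 'rV[int]_n) :
  injective f -> trivIset D (fun i => cube k (f i)).
Proof. by move=> injf i j _ _ [x [/= ci cj]]; apply: injf; rewrite -ci. Qed.

Lemma dyadic_cover k (f : nat -> 'rV[int]_n) :
  (forall m, exists j, f j = m) -> \bigcup_j cube k (f j) = setT.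
Proof.
move=> surjf; apply/seteqP; split => // x _.
by have [j fj] := surjf (cell k x); exists j.
Qed.

Definition enum_rV_int (j : nat) : 'rV[int]_n := odflt 0 (unpickle j).

Lemma enum_rV_int_surj m : exists j, enum_rV_int j = m.
Proof. by exists (pickle m); rewrite /enum_rV_int pickleK. Qed.

Lemma cube_small (U : set 'rV[R]_n) x : open U -> U x ->
  exists k, cube k (cell k x) `<=` U.
Proof.
move=> oU Ux; have /nbhs_ballP[e /= e0 eU] : nbhs x U by exact: open_nbhs_nbhs.
exists (Num.bound e^-1) => y /= /rowP cxy; apply: eU.
set k := Num.bound _ in cxy.
have k0 : 0 < 2 ^+ k :> R by rewrite exprn_gt0.
have ke : e^-1 < 2 ^+ k by exact: upper_nthrootP.
split=> // i j; rewrite ord1 /ball /= -(ltr_pM2l k0).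
apply: (@le_lt_trans _ _ 1); last by rewrite -ltr_pdivrMr // div1r.
rewrite -[X in X * _]ger0_norm ?(ltW k0) // -normrM mulrBr.
have := cxy j; rewrite !cellE => cE.
have := floor_itv (2 ^+ k * x 0 j); have := floor_itv (2 ^+ k * y 0 j).
rewrite cE !intrD => /andP[? ?] /andP[? ?]; rewrite ler_norml; lra.
Qed.

Definition dyadic : set (set (borel 'rV[R]_n)) :=
  [set A | A = set0 \/ exists k m, A = cube k m].

(** Of two dyadic cubes that meet, the finer one is contained in the coarser. *)
Lemma dyadic_setI_closed : setI_closed dyadic.
Proof.
have coarse k d x y : cell (k + d) x = cell (k + d) y -> cell k x = cell k y.
  elim: d => [|d IH]; first by rewrite addn0.
  by move=> cxy; apply: IH; rewrite !(cell_half (k + d)) -addnS cxy.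
have nested k l m m' : (k <= l)%N -> dyadic (cube k m `&` cube l m').
  move=> /subnKC kl; have [[x [cx cx']]|disj] :=
      pselect (exists x, (cube k m `&` cube l m') x); last first.
    by left; rewrite -subset0 => x cx; apply: disj; exists x.
  right; exists l, m'; apply/seteqP; split => [y []//|y cy]; split=> //.
  by rewrite /cube /= -cx; apply: (coarse _ (l - k)%N); rewrite kl cx' cy.
move=> _ _ [->|[k [m ->]]] [->|[l [m' ->]]]; rewrite ?set0I ?setI0; do ?by left.
by have [kl|/ltnW lk] := leqP k l; [|rewrite setIC]; exact: nested.
Qed.

(** An open set is the union of the dyadic cubes that it contains, and there are
only countably many dyadic cubes. *)
Lemma dyadic_generates : @measurable _ (borel 'rV[R]_n) = <<s dyadic >>.
Proof.
apply/seteqP; split.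
  apply: smallest_sub; first exact: smallest_sigma_algebra.
  move=> U oU.
  have -> : U = \bigcup_(p : nat * 'rV[int]_n)
      (if `[< cube p.1 p.2 `<=` U >] then cube p.1 p.2 else set0).
    apply/seteqP; split => [x Ux|x [p _]]; last by case: asboolP => // + cx; exact.
    have [k kU] := cube_small _ _ oU Ux.
    by exists (k, cell k x) => //=; case: asboolP.
  apply: (@countable_bigcupT_measurable _ (g_sigma_algebraType dyadic)).
    exact: countableP.
  move=> p; apply: sub_sigma_algebra; case: asboolP => _; last by left.
  by right; exists p.1, p.2.
apply: smallest_sub; first exact: sigma_algebra_measurable.
by move=> _ [->|[k [m ->]]]; [exact: measurable0|exact: measurable_cube].
Qed.

Section Mass.
Context (mu : {measure set (borel 'rV[R]_n) -> \bar R}).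
Context (mu_leb : is_lebesgue mu).

Lemma mass_translate k m : mu (cube k m) = mu (cube k 0).
Proof.
have [muD _ _] := mu_leb.
by rewrite cube_translate muD //; exact: measurable_cube.
Qed.

(** A cube lies in a compact box. *)
Lemma mass_fin k m : mu (cube k m) \is a fin_num.
Proof.
have [_ mu_fin _] := mu_leb.
rewrite ge0_fin_numE //.
pose K := [set v : 'rV[R]_n | forall i,
  `[2 ^- k * (m 0 i)%:~R, 2 ^- k * (m 0 i + 1)%:~R]%classic (v ord0 i)].
have cK : compact K.
  have segi i :=
    @segment_compact R (2 ^- k * (m 0 i)%:~R) (2 ^- k * (m 0 i + 1)%:~R).
  exact: rV_compact segi.
apply: le_lt_trans (mu_fin _ cK); apply: le_measure; rewrite ?inE.
- exact: measurable_cube.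
- by apply: closed_borel; apply: compact_closed => //; exact: norm_hausdorff.
move=> x /= cx i; rewrite -cx cellE /= in_itv/=.
have k0 : 0 < 2 ^+ k :> R by rewrite exprn_gt0.
have /andP[lo hi] := floor_itv (2 ^+ k * x 0 i).
by rewrite ler_pdivrMl // lo ler_pdivlMl // ltW.
Qed.

(* [N] is 2 ^ n, the number of cubes of the next generation inside a cube. *)
Let N : R := #|{ffun 'I_n -> bool}|%:R.

Lemma mass_split k : mu (cube k 0) = (N%:E * mu (cube k.+1 0))%E.
Proof.
rewrite cube_split measure_fin_bigcup; last 3 first.
- exact: finite_finset.
- apply: trivIset_cube => e f /rowP ef; apply/ffunP => i.
  by have := ef i; rewrite !mxE; case: (e i) (f i) => [] [].
- by move=> e _; exact: measurable_cube.
rewrite (eq_fsbigr (fun=> mu (cube k.+1 0))); last first.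
  by move=> e _; exact: mass_translate.
rewrite (fsbigE (index_enum _)) ?index_enum_uniq //; last first.
  by move=> e _; rewrite mem_index_enum.
rewrite -[mu (cube _ _)]fineK ?mass_fin // sumEFin.
under eq_bigl do rewrite in_setT.
rewrite sumr_const.
by rewrite -EFinM mulr_natl.
Qed.

Lemma mass_cube k m : mu (cube k m) = (fine (mu (cube 0 0)) / N ^+ k)%:E.
Proof.
have N0 : N != 0 by rewrite pnatr_eq0 -lt0n; apply/card_gt0P; exists [ffun=> true].
rewrite mass_translate -[LHS]fineK ?mass_fin //; congr _%:E.
elim: k => [|k IH]; first by rewrite expr0 divr1.
rewrite exprS invfM mulrCA -IH (mass_split k) -[mu (cube k.+1 _)]fineK ?mass_fin //=.
by rewrite mulKf.
Qed.

(** The translates of the unit cube cover the space; were they null, the measure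
would vanish. *)
Lemma mass_gt0 : 0 < fine (mu (cube 0 0)).
Proof.
have [_ _ mu_neq0] := mu_leb.
rewrite lt_neqAle fine_ge0 // andbT eq_sym; apply/negP => /eqP Q0; apply: mu_neq0.
have Z j : mu (cube 0 (enum_rV_int j)) = 0%E by rewrite mass_cube Q0 mul0r.
apply/negligibleP; first exact: measurableT.
rewrite -(dyadic_cover 0 _ enum_rV_int_surj); apply: negligible_bigcup => j.
apply/negligibleP; first exact: measurable_cube.
exact: Z.
Qed.

End Mass.

(** Uniqueness of Lebesgue measure up to a factor. The factor is the ratio of the
masses of the unit cube; by [mass_cube] it is the ratio of the masses of every
dyadic cube. *)
Theorem lebesgue_unique mu nu : is_lebesgue mu -> is_lebesgue nu ->
  exists2 a : R, 0 < a & forall A, measurable A -> nu A = (a%:E * mu A)%E.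
Proof.
move=> mu_leb nu_leb; have mu0 := mass_gt0 mu mu_leb; have nu0 := mass_gt0 nu nu_leb.
have a0 := divr_gt0 nu0 mu0; set a := _ / _ in a0; exists a => // A mA.
rewrite -[RHS]/(mscale (NngNum (ltW a0)) mu A).
apply: (measure_unique dyadic (fun j => cube 0 (enum_rV_int j))) => //.
- exact: dyadic_generates.
- exact: dyadic_setI_closed.
- by move=> j; right; exists 0%N, (enum_rV_int j).
- exact/dyadic_cover/enum_rV_int_surj.
- move=> _ [->|[k [m ->]]]; first by rewrite !measure0.
  rewrite -[RHS]/(a%:E * mu (cube k m))%E.
  rewrite (mass_cube mu mu_leb) (mass_cube nu nu_leb) -EFinM mulrA.
  congr (_ / _)%:E.
  by rewrite /a divfK // gt_eqF.
- by move=> j; rewrite (mass_cube nu nu_leb) ltry.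
Qed.

End DyadicCubes.

(** * Averages and linear changes of variables *)

(** The known case of nonnegative functions applies to both parts of [h]. Since
[a > 0], the factor also passes through their difference when one or both of the
integrals are infinite. *)
Lemma integral_proportional {d} {T : measurableType d} {R : realType}
    (mu nu : {measure set T -> \bar R}) (a : R) (D : set T) (h : T -> \bar R) :
  0 < a -> (forall A, measurable A -> mu A = (a%:E * nu A)%E) ->
  measurable D -> measurable_fun D h ->
  (\int[mu]_(x in D) h x = a%:E * \int[nu]_(x in D) h x)%E.
Proof.
move=> a0 muE mD mh.
have scale (k : T -> \bar R) : measurable_fun D k -> (forall x, 0 <= k x)%E ->
    (\int[mu]_(x in D) k x = a%:E * \int[nu]_(x in D) k x)%E.
  move=> mk k0; rewrite -(ge0_integral_mscale nu mD (NngNum (ltW a0))) //.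
  by apply: eq_measure_integral => A mA _; exact: muE.
rewrite integralE [in RHS]integralE !scale; last 4 first.
- exact: measurable_funeneg.
- exact: funeneg_ge0.
- exact: measurable_funepos.
- exact: funepos_ge0.
have := integral_ge0 nu (fun x _ => funepos_ge0 h x) (D := D).
have := integral_ge0 nu (fun x _ => funeneg_ge0 h x) (D := D).
case: integral => [y||] //; case: integral => [x||] // _ _.
- by rewrite -[RHS]/((a * (x - y))%:E) mulrBr.
- by rewrite gt0_muley ?lte_fin.
- by rewrite gt0_muley ?lte_fin //= gt0_muleNy ?lte_fin.
- by rewrite gt0_muley ?lte_fin //= gt0_muleNy ?lte_fin.
Qed.

(** The measure structure on [pushforward mu f] depends on the measurability of [f]
and so cannot be inferred; here it is attached explicitly. *)
Definition image_measure {d d'} {T : measurableType d} {U : measurableType d'}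
    {R : realType} (mu : {measure set T -> \bar R}) {f : T -> U}
    (mf : measurable_fun setT f) : {measure set U -> \bar R} :=
  measure_function_pushforward__canonical__measure_function_Measure mu mf.

Lemma integral_image_measure {d d'} {T : measurableType d} {U : measurableType d'}
    {R : realType} (mu : {measure set T -> \bar R}) {f : T -> U}
    (mf : measurable_fun setT f) (D : set U) (h : U -> \bar R) :
  measurable D -> measurable_fun D h ->
  (\int[image_measure mu mf]_(y in D) h y =
   \int[mu]_(x in f @^-1` D) h (f x))%E.
Proof.
move=> mD mh; rewrite integralE [RHS]integralE.
rewrite -[fun x => h (f x)]/(h \o f) (funepos_comp h f) (funeneg_comp h f).
congr (_ - _)%E.
- exact: (ge0_integral_pushforward mf mu mD (measurable_funepos mh)
            (fun y _ => funepos_ge0 h y)).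
- exact: (ge0_integral_pushforward mf mu mD (measurable_funeneg mh)
            (fun y _ => funeneg_ge0 h y)).
Qed.

Section LinearChangeOfVariables.
Context {R : realType} {n : nat}.
Notation V := 'rV[R]_n.
Context (f g : {linear V -> V}) (fK : cancel f g) (gK : cancel g f).

Let f_borel : measurable_fun setT (f : borel V -> borel V).
Proof. by apply: continuous_borel; exact: linear_rV_continuous. Qed.

Lemma image_measure_lebesgue (mu : {measure set (borel V) -> \bar R}) :
  is_lebesgue mu -> is_lebesgue (image_measure mu f_borel).
Proof.
move=> [muD mu_fin mu_neq0]; split => //.
- move=> v A mA; rewrite -[LHS]/(mu (f @^-1` _)) -[RHS]/(mu (f @^-1` A)).
  rewrite -(muD (g v) (f @^-1` A)); last first.
    by have := f_borel measurableT A mA; rewrite setTI.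
  congr (mu _); apply/seteqP; split => [x [y Ay yx]|_ [x Ax <-]] /=.
    by exists (g y); rewrite /= ?gK // -linearD yx fK.
  by exists (f x) => //; rewrite linearD gK.
- move=> K cK; rewrite -[X in (X < _)%E]/(mu (f @^-1` K)).
  have -> : f @^-1` K = g @` K.
    by apply/seteqP; split => [x Kx|_ [x Kx <-]]; [exists (f x)|rewrite /= gK].
  apply/mu_fin/continuous_compact => //.
  by apply/continuous_subspaceT/linear_rV_continuous.
Qed.

Lemma lebesgue_linear (mu nu : {measure set (borel V) -> \bar R}) :
  is_lebesgue mu -> is_lebesgue nu ->
  exists2 a : R, 0 < a &
    forall A : set (borel V), measurable A -> mu (f @^-1` A) = (a%:E * nu A)%E.
Proof.
move=> mu_leb nu_leb.
exact: lebesgue_unique nu_leb (image_measure_lebesgue mu mu_leb).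
Qed.

(** The factor between [nu] and the image of [mu] cancels in the quotient. If [B]
has infinite measure, then so has its preimage, and [fine] makes both denominators
zero. *)
Lemma lebesgue_mean_linear (mu nu : {measure set (borel V) -> \bar R})
    (B : set V) (h : V -> R) :
  is_lebesgue mu -> is_lebesgue nu -> measurable (B : set (borel V)) ->
  continuous h ->
  Rintegral nu B h / fine (nu B) =
  Rintegral mu (f @^-1` B) (h \o f) / fine (mu (f @^-1` B)).
Proof.
move=> mu_leb nu_leb mB ch.
have [a a0 muE] := lebesgue_linear mu nu mu_leb nu_leb.
have mh : measurable_fun (B : set (borel V)) (h : borel V -> R).
  by apply: measurable_funTS; exact: (continuous_borel_real h ch).
have mD : measurable_fun (B : set (borel V)) (fun x : borel V => (h x)%:E).
  exact/measurable_EFinP.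
have -> : Rintegral mu (f @^-1` B) (h \o f) = a * Rintegral nu B h.
  rewrite /Rintegral -(integral_image_measure mu f_borel _ _ mB mD).
  rewrite (integral_proportional (image_measure mu f_borel) nu a _ _ a0 muE mB mD).
  by case: integral => //=; rewrite ?gt0_muley ?gt0_muleNy ?lte_fin ?mulr0.
have -> : fine (mu (f @^-1` B)) = a * fine (nu B).
  rewrite (muE B mB).
  by case: (nu B) => //=; rewrite ?gt0_muley ?gt0_muleNy ?lte_fin ?mulr0.
by rewrite -mulf_div divff ?mul1r // gt_eqF.
Qed.

End LinearChangeOfVariables.

(** * Naturality of the Binet-Legendre metric *)

Lemma flat_spec {R : realType} {V : vectType R} {gs : dual V -> dual V -> R}
    {xi : V} (theta : dual V) : (forall phi, gs theta phi = phi xi) ->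
  forall phi, gs (flat gs xi) phi = phi xi.
Proof. by move=> h; rewrite /flat; case: xgetP => [//|/(_ theta)[]]. Qed.

(** The forms dual to [f xi] for [gs'] and to [xi] for [gs] correspond under
composition with [f]. They need not be unique, as [gs] may be degenerate, but
[gs] is symmetric, so the product of two of them only depends on the vectors: if
[theta] and [phi] are dual to [xi] and [eta], then
[gs theta phi = phi xi = theta eta], which depends neither on the choice of
[theta] nor on that of [phi]. *)
Lemma dual_product_natural {R : realType} {V : vectType R}
    {gs gs' : dual V -> dual V -> R} (f : 'End(V)) :
  (lker f == 0)%VS ->
  (forall theta phi, gs theta phi = gs phi theta) ->
  (forall theta, gs 0 theta = 0) ->
  (forall theta phi, gs' theta phi = gs (theta \o f)%VF (phi \o f)%VF) ->
  forall xi eta, dual_product gs' (f xi) (f eta) = dual_product gs xi eta.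
Proof.
move=> kerf symgs gs0 gsE xi eta; rewrite /dual_product gsE.
have flatE zeta : (forall phi : dual V,
      gs (flat gs' (f zeta) \o f)%VF phi = phi zeta /\
      gs (flat gs zeta) phi = phi zeta) \/
    (flat gs' (f zeta) = 0 /\ flat gs zeta = 0).
  have [[theta thetaP]|nex] :=
      pselect (exists theta : dual V, forall phi : dual V, gs theta phi = phi zeta).
    left=> phi; split; last exact: flat_spec thetaP _.
    have theta'P (psi : dual V) : gs' (theta \o f^-1)%VF psi = psi (f zeta).
      by rewrite gsE lker0_compfVK // thetaP comp_lfunE.
    have := flat_spec _ theta'P (phi \o f^-1)%VF.
    by rewrite gsE lker0_compfVK // -!comp_lfunE lker0_compfVK.
  (* Without a dual form on either side, [flat] takes its default value 0. *)
  right; split.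
    rewrite /flat; case: xgetP => // theta' _ /= theta'P; case: nex.
    exists (theta' \o f)%VF => phi.
    have := theta'P (phi \o f^-1)%VF.
    by rewrite gsE lker0_compfVK // -!comp_lfunE lker0_compfVK.
  by rewrite /flat; case: xgetP => // theta _ /= thetaP; case: nex; exists theta.
have [xiP|[-> ->]] := flatE xi; last by rewrite comp_lfun0l !gs0.
have [etaP|[-> ->]] := flatE eta; last by rewrite comp_lfun0l ![gs _ 0]symgs !gs0.
rewrite (xiP _).1 -(xiP (flat gs' (f eta) \o f)%VF).2 symgs (etaP _).1.
by rewrite -(etaP _).2 symgs.
Qed.

Section BinetLegendre.
Context {R : realType} {n : nat} {M : smoothManifold R n}.
Context {F : forall p : M, tangent p -> R}.

Lemma closed_unit_ball (p : M) :
  finsler_metric F -> closed (unit_ball F (p := p)).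
Proof.
move=> [_ normF]; have [F_ge0 homF subF _] := normF p.
have /continuous_closedP cF := sublinear_continuous n (F p) F_ge0 homF subF.
exact: (cF _ (@closed_le R 1)).
Qed.

Lemma binet_legendre_dualC (p : M)
    (mu : {measure set (borel (tangent p)) -> \bar R}) theta phi :
  binet_legendre_dual F mu theta phi = binet_legendre_dual F mu phi theta.
Proof.
by rewrite /binet_legendre_dual; under eq_Rintegral do rewrite mulrC.
Qed.

Lemma binet_legendre_dual0 (p : M)
    (mu : {measure set (borel (tangent p)) -> \bar R}) theta :
  binet_legendre_dual F mu 0 theta = 0.
Proof.
rewrite /binet_legendre_dual /Rintegral integral0_eq ?mulr0 // => v _.
by rewrite lfunE /= mul0r.
Qed.

(** A linear isomorphism that preserves [F] carries one unit ball onto the other, so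
this is [lebesgue_mean_linear] for the product of two linear forms. *)
Lemma binet_legendre_dual_natural (p q : M) (f : 'End('rV[R]_n))
    (mu : {measure set (borel (tangent p)) -> \bar R})
    (nu : {measure set (borel (tangent q)) -> \bar R}) (theta phi : dual 'rV[R]_n) :
  finsler_metric F -> is_lebesgue mu -> is_lebesgue nu ->
  lker f == 0%VS -> (forall v, F q (f v) = F p v) ->
  binet_legendre_dual F nu theta phi =
  binet_legendre_dual F mu (theta \o f)%VF (phi \o f)%VF.
Proof.
move=> F_finsler mu_leb nu_leb kerf Ff.
have ballE : unit_ball F (p := p) = f @^-1` unit_ball F (p := q).
  by apply/seteqP; split => v; rewrite /unit_ball /= Ff.
have prod_cont : continuous (fun v : 'rV[R]_n => theta v * phi v : R).
  move=> v.
  apply: (@continuousM _ _ (theta : 'rV[R]_n -> R) (phi : 'rV[R]_n -> R));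
    exact: linear_rV_continuous.
rewrite /binet_legendre_dual -![_ / _ * _]mulrA; congr (_ * _).
rewrite ![_^-1 * _]mulrC ballE.
rewrite (lebesgue_mean_linear f (f^-1)%VF (lker0_lfunK kerf)
  (lker0_lfunVK kerf) mu _ _ _ mu_leb nu_leb
  (closed_borel _ (closed_unit_ball q F_finsler)) prod_cont).
by congr (_ / _); apply: eq_Rintegral => v _; rewrite /= !comp_lfunE.
Qed.

End BinetLegendre.

Theorem theorem8p2 (R : realType) (n : nat) (M : smoothManifold R n)
    (F : forall p : M, tangent p -> R)
    (F_finsler : finsler_metric F) (F_berwald : berwald 0 F)
    (nabla : connection M) (nabla_assoc : associated_connection 0 F nabla)
    (lambda : forall p : M, {measure set (borel (tangent p)) -> \bar R})
    (lambda_lebesgue : forall p : M, is_lebesgue (lambda p))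
    (gamma : R -> M) (gamma_smooth : smooth_path gamma)
    (P : tangent (gamma 0) -> tangent (gamma 1))
    (P_transport : is_parallel_transport nabla gamma P)
    (xi eta : tangent (gamma 0)) :
  binet_legendre F lambda (gamma 1) (P xi) (P eta) =
  binet_legendre F lambda (gamma 0) xi eta.
Proof.
have [_ normF] := F_finsler.
have [_ _ /(_ gamma P gamma_smooth P_transport) FP] := nabla_assoc.
have linP :=
  parallel_transport_linear F_finsler nabla_assoc gamma_smooth P_transport.
(* All tangent spaces have the same underlying type, so that [P] is read as an
   endomorphism. *)
have [f fE] : exists f : 'End('rV[R]_n), forall v, f v = P v.
  pose Pl : {linear 'rV[R]_n -> 'rV[R]_n} :=
    HB.pack (P : 'rV[R]_n -> 'rV[R]_n) (GRing.isLinear.Build _ _ _ _ _ linP).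
  by exists (linfun Pl) => v; rewrite lfunE.
have kerf : lker f == 0%VS.
  rewrite -subv0; apply/subvP => v; rewrite memv_ker fE memv0 => /eqP Pv0.
  have [_ hom1 _ _] := normF (gamma 1).
  have [_ _ _ def0] := normF (gamma 0).
  apply/eqP/def0; rewrite -FP [P v]Pv0 -(scale0r (0 : tangent (gamma 1))).
  by rewrite hom1 ?mul0r.
rewrite /binet_legendre -!fE.
apply: (dual_product_natural f kerf).
- exact: binet_legendre_dualC.
- exact: binet_legendre_dual0.
- move=> theta phi; apply: binet_legendre_dual_natural => // v.
  by rewrite fE FP.
Qed.
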